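(* The category $\mathsf{detSys}^{\mathsf{ef}}$ of nonempty deterministic dynamical systems with embedding-factor pairs as morphisms is semi-algebroidal, and its category-theoretically finite objects are precisely the deterministic systems in it that are isomorphic to a shift.
   Context: A deterministic system is a pair $(X,T)$ with $X$ a zero-dimensional (having a basis of clopen sets), second-countable, compact Hausdorff space and $T:X\to X$ continuous. A factor $f:(Y,S)\to(X,T)$ is a continuous surjection with $f\circ S=T\circ f$. An embedding-factor pair (ef-pair) $(e,f):(X,T)\to(Y,S)$ consists of a factor $f:(Y,S)\to(X,T)$ together with the multifunction $e:x\mapsto f^{-1}(x)$ from $X$ to $Y$ (the embedding uniquely determined by $f$); composition is $(e',f')\circ(e,f)=(e'\circ e,f\circ f')$. Thus a morphism $(X,T)\to(Y,S)$ of $\mathsf{detSys}^{\mathsf{ef}}$ amounts to a factor $(Y,S)\to(X,T)$. A shift is a closed subset $X\subseteq A^\omega$ for some finite alphabet $A$ (with $A^\omega$ carrying the product of discrete topologies) such that $\sigma[X]\subseteq X$, where $\sigma(x)_n=x_{n+1}$; it is regarded as the system $(X,\sigma)$. An $\omega$-chain in a category $\mathsf{C}$ is a sequence of objects $A_i$ with morphisms $A_i\to A_{i+1}$ ($i\in\omega$). An object $B$ of $\mathsf{C}$ is (category-theoretically) finite if for every $\omega$-chain with colimit $(A,f_i)$ and every morphism $g:B\to A$ there is $n$ such that for all $i\geq n$ there is a unique morphism $h:B\to A_i$ with $g=f_i\circ h$. $\mathsf{C}$ is semi-algebroidal if all its morphisms are monic, every object is a colimit of an $\omega$-chain of finite objects,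 and every $\omega$-chain of finite objects has a colimit in $\mathsf{C}$. *)

(* Defs.v *)
From HB Require Import structures.
From mathcomp Require Import all_boot all_order all_algebra.
From mathcomp Require Import boolp classical_sets functions cardinality.
From mathcomp Require Import topology.

Set Implicit Arguments.
Unset Strict Implicit.
Unset Printing Implicit Defensive.

Local Open Scope classical_set_scope.

Record category := Category {
  Obj :> Type;
  Hom : Obj -> Obj -> Type;
  idm : forall A, Hom A A;
  compm : forall A B C, Hom B C -> Hom A B -> Hom A C;
  compm1 : forall A B (f : Hom A B), compm f (idm A) = f;
  comp1m : forall A B (f : Hom A B), compm (idm B) f = f;
  compmA : forall A B C D (h : Hom C D) (g : Hom B C) (f : Hom A B),
    compm h (compm g f) = compm (compm h g) f }.

Arguments Hom {c} A B.
Arguments idm {c} A.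
Arguments compm {c A B C} g f : rename.

Section CategoryTheory.
Variable C : category.

Definition monic (A B : C) (f : Hom A B) :=
  forall (Z : C) (g h : Hom Z A), compm f g = compm f h -> g = h.

Definition isomorphic (A B : C) :=
  exists (f : Hom A B) (g : Hom B A), compm g f = idm A /\ compm f g = idm B.

Record omega_chain := OmegaChain {
  chain_ob :> nat -> C;
  chain_mor : forall i, Hom (chain_ob i) (chain_ob i.+1) }.

Definition is_cocone (D : omega_chain) (A : C) (f : forall i, Hom (D i) A) :=
  forall i, compm (f i.+1) (chain_mor D i) = f i.

Definition is_colimit (D : omega_chain) (A : C) (f : forall i, Hom (D i) A) :=
  is_cocone f /\
  forall (B : C) (g : forall i, Hom (D i) B), is_cocone g ->
    exists! h : Hom A B, forall i, compm h (f i) = g i.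

Definition finite_object (B : C) :=
  forall (D : omega_chain) (A : C) (f : forall i, Hom (D i) A),
    is_colimit f ->
    forall g : Hom B A, exists n, forall i, n <= i ->
      exists! h : Hom B (D i), g = compm (f i) h.

Definition semi_algebroidal :=
  [/\ forall (A B : C) (f : Hom A B), monic f,
      forall A : C, exists (D : omega_chain) (f : forall i, Hom (D i) A),
        (forall i, finite_object (D i)) /\ is_colimit f &
      forall D : omega_chain, (forall i, finite_object (D i)) ->
        exists (A : C) (f : forall i, Hom (D i) A), is_colimit f].

End CategoryTheory.

(* The library's [zero_dimensional] is the separation of distinct points by
   clopen sets; here zero-dimensionality is the existence of a clopen basis. *)
Definition has_clopen_basis (X : topologicalType) :=
  exists2 B : set_system X, B `<=` @clopen X & basis B.

Record detSys := DetSys {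
  space :> topologicalType;
  space_zero_dim : has_clopen_basis space;
  space_second_countable : @second_countable space;
  space_compact : compact [set: space];
  space_hausdorff : hausdorff_space space;
  dyn : space -> space;
  dyn_continuous : continuous dyn }.

Arguments dyn : clear implicits.

Record factor (Y X : detSys) := Factor {
  fact_fun :> Y -> X;
  fact_continuous : continuous fact_fun;
  fact_surj : forall x : X, exists y : Y, fact_fun y = x;
  fact_equivariant : forall y : Y, fact_fun (dyn Y y) = dyn X (fact_fun y) }.

(* An ef-pair from X to Y: its factor goes from Y to X, and its embedding is a
   multifunction from X to Y. *)
Record ef_pair (X Y : detSys) := EfPair {
  ef_emb : X -> set Y;
  ef_fact : factor Y X;
  ef_embE : forall x, ef_emb x = ef_fact @^-1` [set x] }.

Definition mfun_comp (X Y Z : Type) (e' : Y -> set Z) (e : X -> set Y) :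
  X -> set Z := fun x => \bigcup_(y in e x) e' y.

Lemma factor_eq (Y X : detSys) (f g : factor Y X) :
  (forall y, f y = g y) -> f = g.
Proof.
case: f => f cf sf ef; case: g => g cg sg eg /= fg.
have {}fg : f = g by exact/funext.
by subst g; congr Factor; exact: Prop_irrelevance.
Qed.

Lemma ef_pair_eq (X Y : detSys) (p q : ef_pair X Y) :
  (forall y, ef_fact p y = ef_fact q y) -> p = q.
Proof.
case: p => e f E; case: q => e' f' E' /= /factor_eq ff'; subst f'.
have ee' : e = e' by apply/funext => x; rewrite E E'.
by subst e'; congr EfPair; exact: Prop_irrelevance.
Qed.

Program Definition factor_id (X : detSys) : factor X X := @Factor X X id _ _ _.
Next Obligation. by move=> X x. Qed.
Next Obligation. by move=> X x; exists x. Qed.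
Next Obligation. by []. Qed.

Program Definition factor_comp (X Y Z : detSys) (f : factor Y X)
  (g : factor Z Y) : factor Z X := @Factor Z X (f \o g) _ _ _.
Next Obligation.
move=> X Y Z f g z.
by apply: continuous_comp; exact: fact_continuous.
Qed.
Next Obligation.
move=> X Y Z f g x; have [y <-] := fact_surj f x.
by have [z <-] := fact_surj g y; exists z.
Qed.
Next Obligation. by move=> X Y Z f g z /=; rewrite !fact_equivariant. Qed.

Program Definition ef_id (X : detSys) : ef_pair X X :=
  @EfPair X X (fun x => [set x]) (factor_id X) _.
Next Obligation. by []. Qed.

Program Definition ef_comp (X Y Z : detSys) (q : ef_pair Y Z)
  (p : ef_pair X Y) : ef_pair X Z :=
  @EfPair X Z (mfun_comp (ef_emb q) (ef_emb p))
    (factor_comp (ef_fact p) (ef_fact q)) _.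
Next Obligation.
move=> X Y Z q p x; rewrite /mfun_comp ef_embE; apply/seteqP; split => z /=.
  by case=> y /= yx; rewrite ef_embE /= => ->.
by move=> zx; exists (ef_fact q z) => //; rewrite ef_embE.
Qed.

Record nedetSys := NeDetSys {
  nedetSys_val :> detSys;
  nedetSys_nonempty : [set: nedetSys_val] !=set0 }.

Program Definition detSysEf : category :=
  @Category nedetSys (fun X Y => ef_pair X Y) (fun X => ef_id X)
    (fun X Y Z q p => ef_comp q p) _ _ _.
Next Obligation. by move=> X Y p; exact: ef_pair_eq. Qed.
Next Obligation. by move=> X Y p; exact: ef_pair_eq. Qed.
Next Obligation. by move=> X Y Z W r q p; exact: ef_pair_eq. Qed.

Definition full_shift (A : finType) : topologicalType :=
  {ptws nat -> discrete_topology A}.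

Definition shift_map (A : finType) (x : full_shift A) : full_shift A :=
  fun n => x n.+1.

Record shift (A : finType) := Shift {
  shift_set :> set (full_shift A);
  shift_closed : closed shift_set;
  shift_stable : @shift_map A @` shift_set `<=` shift_set }.

Section ShiftSystem.
Variable A : finType.
Implicit Types x y : full_shift A.

Let cylinder n (w : seq A) : set (full_shift A) :=
  [set x | mkseq x n = w].

Let clopen_cylinder n w : clopen (cylinder n w).
Proof.
elim: n w => [|n IHn] w; case/lastP: w => [|w a].
- by rewrite (_ : cylinder 0 [::] = setT); [exact: clopenT | exact/seteqP].
- rewrite (_ : cylinder 0 _ = set0); first exact: clopen0.
  by apply/seteqP; split=> // x /= /esym/eqP; rewrite -size_eq0 size_rcons.
- rewrite (_ : cylinder n.+1 _ = set0); first exact: clopen0.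
  by apply/seteqP; split=> // x /= /eqP; rewrite -size_eq0 size_mkseq.
- rewrite (_ : cylinder n.+1 _ = cylinder n w `&`
      (fun x => x n : discrete_topology A) @^-1` [set a]); last first.
    apply/seteqP; split => x; rewrite /cylinder /setI /preimage /mkset mkseqS.
      by move/rcons_inj => [-> ->].
    by move=> [-> ->].
  apply: clopenI => //; apply: preimage_clopen.
    by split; [exact: discrete_open | exact: discrete_closed].
  exact: (@proj_continuous nat (fun=> discrete_topology A)).
Qed.

Let nbhs_cylinder x U : nbhs x U -> exists n, cylinder n (mkseq x n) `<=` U.
Proof.
pose F := filter_from [set: nat] (fun n => cylinder n (mkseq x n)).
have cylE n y : mkseq y n = mkseq x n -> forall i, i < n -> y i = x i.
  move=> yx i ni; have := congr1 (nth (x i) ^~ i) yx.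
  by rewrite !nth_mkseq.
have FF : Filter F.
  apply: filter_from_filter => [|i j _ _]; first by exists 0.
  exists (maxn i j) => // y /= /cylE xy.
  by split; apply/eq_in_map => k; rewrite mem_iota => /andP[_ kn]; apply: xy;
    rewrite leq_max kn ?orbT.
suff Fx : F --> x by move=> /Fx[n _ nU]; exists n.
apply/cvg_sup => N V [W [[O oO <-] /= OxN] WV].
by exists N.+1 => // y /cylE yx; apply: WV => /=; rewrite yx.
Qed.

Variable X : shift A.

Let cylX (p : nat * seq A) : set (shift_set X) :=
  set_val @^-1` cylinder p.1 p.2.

Let clopen_cylX p : clopen (cylX p).
Proof.
by apply: preimage_clopen => //; exact: initial_continuous.
Qed.

Let basis_cylX : basis (range cylX).
Proof.
split=> [_ [p _ <-]|x U [_ [[O oO <-] /= Ox] OU]]; first by case: (clopen_cylX p).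
have [n nO] := nbhs_cylinder (open_nbhs_nbhs (conj oO Ox)).
exists (cylX (n, mkseq (set_val x) n)); first by split=> //; exists (n, mkseq (set_val x) n).
by move=> y /nO /OU.
Qed.

Lemma shift_zero_dim : has_clopen_basis (shift_set X).
Proof. by exists (range cylX) => // _ [p _ <-]. Qed.

Lemma shift_second_countable : @second_countable (shift_set X).
Proof. exists (range cylX); last exact: basis_cylX.
exact: (card_le_trans (card_image_le _ _) (countableP _)). Qed.

Lemma shift_hausdorff : hausdorff_space (shift_set X).
Proof.
move=> x y xy; apply: val_inj; apply/(@hausdorff_product nat (fun=> discrete_topology A)).
  by move=> _; exact: discrete_hausdorff.
move=> U V Ux Vy.
have [z [Uz Vz]] := xy _ _ (initial_continuous Ux) (initial_continuous Vy).
by exists (set_val z).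
Qed.

Lemma shift_compact : compact [set: shift_set X].
Proof.
have cA : compact [set: full_shift A].
  have := @tychonoff nat (fun=> discrete_topology A) (fun=> setT).
  rewrite (_ : mkset _ = setT); last exact/seteqP.
  by apply=> _; exact/finite_compact/finite_finset.
have cX : compact (shift_set X).
  exact: (subclosed_compact (shift_closed (s := X)) cA).
move=> F PF _; have [|p [Xp pF]] := cX (set_val @ F) (fmap_proper_filter _ PF).
  suff XT : set_val @^-1` shift_set X = [set: shift_set X].
    by rewrite nbhs_simpl /= XT; exact: filterT.
  by apply/seteqP; split=> // x _; apply: set_valP.
exists (exist _ p (mem_set Xp)); split=> // U V FU [_ [[O oO <-] /= Op] OV].
have [] := pF (set_val @` U) O; last first.
- by move=> _ [[x Ux <-] Ox]; exists x; split=> //; exact: OV.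
- exact: open_nbhs_nbhs.
- by apply: (@filterS _ F _ U) FU => x Ux /=; exists x.
Qed.

Definition shift_dyn (x : shift_set X) : shift_set X :=
  exist _ (shift_map (set_val x))
    (mem_set (shift_stable (imageP (@shift_map A) (set_valP x)))).

Lemma shift_dyn_continuous : continuous shift_dyn.
Proof.
move=> x U [_ [[O oO <-] /= Ox] OU].
have [n nO] := nbhs_cylinder (open_nbhs_nbhs (conj oO Ox)).
have Cx : cylX (n.+1, mkseq (set_val x) n.+1) x by [].
have := open_nbhs_nbhs (conj (proj1 (clopen_cylX _)) Cx).
apply: filterS => y /= yx; apply/OU/nO => /=.
have := congr1 behead yx; rewrite /mkseq /= -[1]addn0 !iotaDl -!map_comp.
exact.
Qed.

Definition shift_sys : detSys :=
  DetSys shift_zero_dim shift_second_countable shift_compact shift_hausdorff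
    shift_dyn_continuous.

End ShiftSystem.

(* Main.v *)
(** An ef-pair is determined by its factor, read backwards, so omega-chains are
    towers of factors and a colimit is a limit of systems. By compactness a
    cocone whose factors jointly separate points is already a colimit: nested
    nonempty fibres meet, and the factors generate the topology. The inverse
    limit of a tower is such a cocone, hence every colimit cocone separates
    points.

    A sequence of clopen sets separating the points of X yields, for each n, the
    shift of itineraries through the first n sets; these shifts form a chain
    with colimit X. If B is a shift and g : L -> B is a factor of the colimit of
    a chain D, then compactness of L * L makes the first letter of g depend only
    on some D n; by equivariance so does all of g, which gives finiteness.
    Conversely, if B is finite, its identity factors through a term of its chain
    of shifts, and B is isomorphic to that term. *)
From mathcomp Require Import all_boot.
From mathcomp Require Import boolp classical_sets functions cardinality.
From mathcomp Require Import topology.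
Require Import Defs.

Set Implicit Arguments.
Unset Strict Implicit.
Unset Printing Implicit Defensive.

Local Open Scope classical_set_scope.

(** * Compact Hausdorff spaces and clopen separation *)

Lemma continuousT_comp (X Y Z : topologicalType) (f : X -> Y) (g : Y -> Z) :
  continuous f -> continuous g -> continuous (g \o f).
Proof. by move=> cf cg x; apply: continuous_comp; [exact: cf | exact: cg]. Qed.

Lemma compact_nested_inhabited (X : topologicalType) (K : nat -> set X) :
  compact [set: X] -> (forall i, closed (K i)) -> (forall i, K i !=set0) ->
  (forall i, K i.+1 `<=` K i) -> exists x, forall i, K i x.
Proof.
move=> cX cK K0 KS.
have Kle i j : i <= j -> K j `<=` K i.
  elim: j => [|j IHj]; first by rewrite leqn0 => /eqP ->.
  rewrite leq_eqVlt ltnS => /orP[/eqP ->//|/IHj Kji].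
  exact: subset_trans Kji.
have PF : ProperFilter (filter_from [set: nat] K).
  apply: filter_from_proper => [|i _]; last exact: K0.
  apply: filter_from_filter => [|i j _ _]; first by exists 0.
  by exists (maxn i j) => // x Kx; split; apply: Kle Kx;
    rewrite ?leq_maxl ?leq_maxr.
have [|p [_ pK]] := cX _ PF; first exact: filterT.
exists p => i; apply: cK => U pU; apply: pK => //.
by exists i.
Qed.

Lemma compact_closed_image (X Y : topologicalType) (f : X -> Y) (C : set X) :
  compact [set: X] -> hausdorff_space Y -> continuous f -> closed C ->
  closed (f @` C).
Proof.
move=> cX hY cf clC; apply: compact_closed => //.
apply: continuous_compact; first exact: continuous_subspaceT.
exact: subclosed_compact cX _.
Qed.

(** The map [p] is closed, and the preimage of a closed set under [h] is the [p]-image of its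
    preimage under [h \o p]. *)
Lemma compact_quotient_continuous (X Y Z : topologicalType) (p : X -> Y)
    (h : Y -> Z) :
  compact [set: X] -> hausdorff_space Y -> continuous p ->
  (forall y, exists x, p x = y) -> continuous (h \o p) -> continuous h.
Proof.
move=> cX hY cp sp chp; apply/continuous_closedP => C clC.
have -> : h @^-1` C = p @` ((h \o p) @^-1` C).
  apply/seteqP; split=> [y Cy|_ [x Cx <-]//].
  by have [x xy] := sp y; exists x; rewrite /= ?xy.
apply: compact_closed_image => //.
by move/continuous_closedP : chp; apply.
Qed.

Lemma closed_fiber (X Y : topologicalType) (f : X -> Y) (y : Y) :
  hausdorff_space Y -> continuous f -> closed (f @^-1` [set y]).
Proof.
move=> hY /continuous_closedP; apply.
exact/accessible_closed_set1/hausdorff_accessible.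
Qed.

Lemma closed_equalizer (X Y : topologicalType) (f g : X -> Y) :
  hausdorff_space Y -> continuous f -> continuous g ->
  closed [set x | f x = g x].
Proof.
move=> hY cf cg x xcl; apply: hY => U V Ux Vx.
have nU : nbhs x (f @^-1` U) := cf x _ Ux.
have nV : nbhs x (g @^-1` V) := cg x _ Vx.
have [y [/= fg [Uy Vy]]] := xcl _ (filterI nU nV).
by exists (f y); split=> //; rewrite fg.
Qed.

Lemma open_equalizer_discrete (X : topologicalType) (A : finType)
    (f g : X -> discrete_topology A) :
  continuous f -> continuous g -> open [set x | f x = g x].
Proof.
move=> cf cg; rewrite openE => x /= fgx; rewrite /interior.
have nf : nbhs x (f @^-1` [set f x]) by exact: cf.
have ng : nbhs x (g @^-1` [set g x]) by exact: cg.
by apply: filterS (filterI nf ng) => y /= [-> ->].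
Qed.

Lemma compact_jointly_injective_nbhs (X : topologicalType)
    (Y : nat -> topologicalType) (f : forall i, X -> Y i) (x : X) (U : set X) :
  compact [set: X] -> (forall i, hausdorff_space (Y i)) ->
  (forall i, continuous (f i)) ->
  (forall i x y, f i.+1 x = f i.+1 y -> f i x = f i y) ->
  (forall y, (forall i, f i y = f i x) -> y = x) ->
  open U -> U x -> exists i V, [/\ open V, V (f i x) & f i @^-1` V `<=` U].
Proof.
move=> cX hY cf fS finj oU Ux.
(* If some fibre of [f i] through [x] lies in [U], the complement of the image of [~]
   U[serves as]V[. Otherwise the fibres through]x[all meet]~[U]; these traces are closed and nested,
   and a common point would equal [x] by joint injectivity, although [x] is in [U]. *)
have [[i iU]|noi] := pselect (exists i, f i @^-1` [set f i x] `<=` U).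
  exists i, (~` (f i @` (~` U))); split.
  - by apply/closed_openC/compact_closed_image => //; exact: open_closedC.
  - by move=> [y nUy yx]; apply/nUy/iU.
  - by move=> y /= nUy; apply: contrapT => Uy; apply: nUy; exists y.
have [|||y yK] := @compact_nested_inhabited X
    (fun i => f i @^-1` [set f i x] `&` ~` U) cX.
- by move=> i; apply: closedI; [exact: closed_fiber | exact: open_closedC].
- move=> i; apply: contrapT => Ki0; apply: noi; exists i => y yx.
  by apply: contrapT => nUy; apply: Ki0; exists y.
- by move=> i y [/= yx nUy]; split=> //; exact: fS.
- have yx : y = x by apply: finj => i; have [] := yK i.
  by have [_] := yK 0; rewrite yx.
Qed.

Lemma compact_set_type (X : topologicalType) (A : set X) :
  compact A -> compact [set: A].
Proof.
move=> cA F PF _.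
have [|p [Ap pF]] := cA (set_val @ F) (fmap_proper_filter _ PF).
  suff AT : set_val @^-1` A = [set: A].
    by rewrite nbhs_simpl /= AT; exact: filterT.
  by apply/seteqP; split=> // x _; exact: set_valP.
exists (exist _ p (mem_set Ap)); split=> // U V FU [_ [[O oO <-] /= Op] OV].
have [] := pF (set_val @` U) O; last first.
- by move=> _ [[x Ux <-] Ox]; exists x; split=> //; exact: OV.
- exact: open_nbhs_nbhs.
- by apply: (@filterS _ F _ U) FU => x Ux /=; exists x.
Qed.

Lemma hausdorff_set_type (X : topologicalType) (A : set X) :
  hausdorff_space X -> hausdorff_space A.
Proof.
move=> hX x y xy; apply: val_inj; apply: hX => U V Ux Vy.
have [z [Uz Vz]] := xy _ _ (initial_continuous Ux) (initial_continuous Vy).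
by exists (set_val z).
Qed.

Lemma continuous_to_discrete (X : topologicalType) (A : finType)
    (c : X -> discrete_topology A) :
  (forall x, \forall y \near x, c y = c x) -> continuous c.
Proof.
move=> cc x U cxU; apply: filterS (cc x) => y /= ->.
exact: nbhs_singleton.
Qed.

(** The given clopen basis may be uncountable, so the sequence is indexed by pairs from a countable
    basis: for each pair one chooses a clopen set containing the first member and missing the
    second, if there is one. Distinct points are separated by some clopen [W], and basic
    neighbourhoods inside [W] and inside its complement form such a pair. *)
Lemma clopen_separating_sequence (X : detSys) : exists2 C : nat -> set X,
  (forall n, clopen (C n)) & forall x y, (forall n, C n x <-> C n y) -> x = y.
Proof.
have [B /countable_injP[e einj] [oB Bbasis]] := @space_second_countable X.
have [B' B'clopen [_ B'basis]] := space_zero_dim X.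
pose sep (n m : nat) (C : set X) := clopen C /\
  forall U V, B U -> B V -> e U = n -> e V = m -> U `<=` C /\ V `<=` ~` C.
(* The default [set0] is clopen, so indices without a separating set do no harm. *)
pose C0 (p : nat * nat) := if pselect (exists C, sep p.1 p.2 C) is left h
  then projT1 (cid h) else set0.
exists (fun n => if unpickle n is Some p then C0 p else set0).
  move=> n; case: unpickle => [p|]; last exact: clopen0.
  rewrite /C0; case: pselect => [h|_]; last exact: clopen0.
  by case: (projT2 (cid h)).
move=> x y xyC; apply: contrapT => xy.
have [W [B'W Wx Wy]] : exists W, [/\ B' W, W x & ~ W y].
  have oy : open (~` [set y]).
    apply/closed_openC/accessible_closed_set1/hausdorff_accessible.
    exact: space_hausdorff.
  have [W [B'W Wx WU]] := B'basis x _ (open_nbhs_nbhs (conj oy xy)).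
  by exists W; split=> // /WU; exact.
have [oW clW] := B'clopen _ B'W.
have [U [BU Ux UW]] := Bbasis x _ (open_nbhs_nbhs (conj oW Wx)).
have [V [BV Vy VW]] := Bbasis y _ (open_nbhs_nbhs (conj (closed_openC clW) Wy)).
have := xyC (pickle (e U, e V)); rewrite pickleK /C0 /=.
case: pselect => [h|]; last first.
  case; exists W; split=> // U' V' BU' BV' eU eV.
  have -> : U' = U by apply: einj eU; exact/mem_set.
  by have -> : V' = V by apply: einj eV; exact/mem_set.
case: (cid h) => /= C [_ /(_ U V BU BV erefl erefl)[UC VC]] CE.
by apply: VC Vy _; apply/CE/UC.
Qed.

(** * Factors, cocones and colimits *)

(** Take [g \o s] for any set-theoretic section [s] of [p]. The section need not be continuous: the
    composite with [p] is [g], and [p] is a quotient map. *)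
Lemma factor_lift (L D B : detSys) (p : factor L D) (g : factor L B) :
  (forall x y, p x = p y -> g x = g y) ->
  exists h : factor D B, forall x, h (p x) = g x.
Proof.
move=> pg; have /choice[s ps] := fact_surj p.
have hp x : g (s (p x)) = g x by apply: pg; rewrite ps.
have ch : continuous (g \o s).
  apply: (@compact_quotient_continuous L D B p).
  - exact: space_compact.
  - exact: space_hausdorff.
  - exact: fact_continuous.
  - exact: fact_surj.
  - rewrite (_ : _ \o p = g); first exact: fact_continuous.
    exact/funext.
have sh x : exists y, (g \o s) y = x.
  by have [y <-] := fact_surj g x; exists (p y); exact: hp.
have eh y : (g \o s) (dyn D y) = dyn B ((g \o s) y).
  have [x <-] := fact_surj p y.
  by rewrite -fact_equivariant /= !hp fact_equivariant.
by exists (Factor ch sh eh).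
Qed.

Definition ef_of_factor (X Y : detSys) (f : factor Y X) : ef_pair X Y :=
  @EfPair X Y (fun x => f @^-1` [set x]) f (fun=> erefl).

Lemma ef_eqP (X Y : detSys) (p q : ef_pair X Y) :
  p = q <-> forall y, ef_fact p y = ef_fact q y.
Proof. by split=> [->//|]; exact: ef_pair_eq. Qed.

(** On factors, composing with [f] is precomposition with the surjection [ef_fact f], which can be
    cancelled. *)
Lemma detSysEf_monic (X Y : detSysEf) (f : Hom X Y) : monic f.
Proof.
move=> Z g h /ef_eqP gh; apply: ef_pair_eq => x.
by have [y <-] := fact_surj (ef_fact f) x; exact: gh.
Qed.

Lemma cocone_fact (D : omega_chain detSysEf) (A : detSysEf)
    (f : forall i, Hom (D i) A) (i : nat) (a : A) : is_cocone f ->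
  ef_fact (chain_mor D i) (ef_fact (f i.+1) a) = ef_fact (f i) a.
Proof. by move=> /(_ i)/ef_eqP/(_ a). Qed.

Lemma cocone_fact_le (D : omega_chain detSysEf) (A : detSysEf)
    (f : forall i, Hom (D i) A) (i j : nat) (a b : A) : is_cocone f -> i <= j ->
  ef_fact (f j) a = ef_fact (f j) b -> ef_fact (f i) a = ef_fact (f i) b.
Proof.
move=> cf; elim: j => [|j IHj]; first by rewrite leqn0 => /eqP ->.
rewrite leq_eqVlt ltnS => /orP[/eqP ->//|/IHj {}IHj] fab; apply: IHj.
by rewrite -(cocone_fact j a cf) -(cocone_fact j b cf) fab.
Qed.

Lemma cocone_inhabited (D : omega_chain detSysEf) (A : detSysEf)
    (f : forall i, Hom (D i) A) (d : forall i, D i) : is_cocone f ->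
  (forall i, ef_fact (chain_mor D i) (d i.+1) = d i) ->
  exists a, forall i, ef_fact (f i) a = d i.
Proof.
move=> cf dD; apply: (@compact_nested_inhabited A
    (fun i => ef_fact (f i) @^-1` [set d i])).
- exact: space_compact.
- by move=> i; apply: closed_fiber;
    [exact: space_hausdorff | exact: fact_continuous].
- by move=> i; have [a <-] := fact_surj (ef_fact (f i)) (d i); exists a.
- by move=> i a /= fa; rewrite -(cocone_fact _ _ cf) fa dD.
Qed.

Lemma jointly_injective_colimit (D : omega_chain detSysEf) (A : detSysEf)
    (f : forall i, Hom (D i) A) : is_cocone f ->
  (forall a b, (forall i, ef_fact (f i) a = ef_fact (f i) b) -> a = b) ->
  is_colimit f.
Proof.
move=> cf finj; split=> // B g cg.
(* The mediating factor sends [b] to the point of [A] with the same coordinates; that point exists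
   by compactness of [A] and is unique by joint injectivity. *)
have /choice[h fh] : forall b, exists a, forall i,
    ef_fact (f i) a = ef_fact (g i) b.
  move=> b; apply: (@cocone_inhabited _ _ _ (fun i => ef_fact (g i) b)) => // i.
  exact: cocone_fact.
have ch : continuous h.
  move=> b U; rewrite nbhsE => -[O [oO Ob] OU].
  have [i [V [oV Vb VO]]] : exists i V, [/\ open V, V (ef_fact (f i) (h b)) &
      ef_fact (f i) @^-1` V `<=` O].
    apply: compact_jointly_injective_nbhs => //.
    - exact: space_compact.
    - by move=> i; exact: space_hausdorff.
    - by move=> i; exact: fact_continuous.
    - by move=> i x y; exact: cocone_fact_le.
    - by move=> y yb; exact: finj.
  have : nbhs b (ef_fact (g i) @^-1` V).
    by apply: fact_continuous; apply: open_nbhs_nbhs; split; rewrite // -fh.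
  by apply: filterS => x /= Vx; apply/OU/VO; rewrite /= fh.
(* Same existence argument with the two cocones exchanged: compactness of [B] realises the
   coordinates of [a]. *)
have sh a : exists b, h b = a.
  have [//|i|b gb] := @cocone_inhabited _ _ g (fun i => ef_fact (f i) a).
    exact: cocone_fact.
  by exists b; apply: finj => i; rewrite fh gb.
have eh b : h (dyn B b) = dyn A (h b).
  by apply: finj => i; rewrite fh !fact_equivariant fh.
exists (ef_of_factor (Factor ch sh eh)); split.
  by move=> i; apply: ef_pair_eq => b; exact: fh.
move=> k kf; apply: ef_pair_eq => b /=; apply: finj => i.
by rewrite fh -(kf i).
Qed.

(** * Inverse limits of towers of factors *)

(** Above level [i] the thread is built by choosing preimages recursively; below it the values are
    forced by the bonding maps. The induction drops the bottom level of the tower, so the inductive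
    step only adds the value [b 0 (x 0)]. *)
Lemma surjective_tower_thread (Y : nat -> Type) (b : forall i, Y i.+1 -> Y i)
    (i : nat) (y : Y i) : (forall j z, exists z', b j z' = z) ->
  exists x : forall j, Y j, (forall j, b j (x j.+1) = x j) /\ x i = y.
Proof.
elim: i Y b y => [|i IHi] Y b y bsurj.
  have s j z : {z' | b j z' = z} by exact/cid/bsurj.
  pose x := fix x j : Y j := if j is j'.+1 then sval (s j' (x j')) else y.
  by exists x; split=> // j /=; case: (s j (x j)).
have [x [bx xi]] :=
  IHi (fun j => Y j.+1) (fun j => b j.+1) y (fun j => bsurj _).
exists (fun j => if j is j'.+1 then x j' else b 0 (x 0)); split=> //.
by case.
Qed.

Section InverseLimit.
Variable D : omega_chain detSysEf.

Let bond i : factor (D i.+1) (D i) := ef_fact (chain_mor D i).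

Definition threads : set (prod_topology (fun i => D i : topologicalType)) :=
  [set x | forall i, bond i (x i.+1) = x i].

Definition thread_proj (i : nat) (x : threads) : D i := set_val x i.

Lemma thread_proj_bond i x : bond i (thread_proj i.+1 x) = thread_proj i x.
Proof. exact: (set_valP x). Qed.

Lemma thread_ext (x y : threads) :
  (forall i, thread_proj i x = thread_proj i y) -> x = y.
Proof. by move=> xy; apply/val_inj/functional_extensionality_dep. Qed.

Lemma coord_continuous i :
  continuous (fun x : prod_topology (fun i => D i : topologicalType) => x i).
Proof. exact: (@proj_continuous nat (fun i => D i : topologicalType) i). Qed.

Lemma thread_proj_continuous i : continuous (@thread_proj i).
Proof.
apply: (continuousT_comp _ (@coord_continuous i)); exact: initial_continuous.
Qed.

Lemma prod_hausdorff :
  hausdorff_space (prod_topology (fun i => D i : topologicalType)).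
Proof.
apply: (@hausdorff_product nat (fun i => D i : topologicalType)) => i.
exact: space_hausdorff.
Qed.

Lemma threads_closed : closed threads.
Proof.
have -> : threads = \bigcap_i [set x | bond i (x i.+1) = x i].
  by apply/seteqP; split=> [x xD i _|x xD i]; [exact: xD | exact: xD].
apply: closed_bigI => i _; apply: closed_equalizer.
- exact: space_hausdorff.
- apply: (continuousT_comp (@coord_continuous i.+1)).
  exact: (@fact_continuous _ _ (bond i)).
- exact: coord_continuous.
Qed.

Lemma threads_compact : compact [set: threads].
Proof.
apply/compact_set_type/(subclosed_compact threads_closed).
  have := @tychonoff nat (fun i => D i : topologicalType) (fun=> setT).
  by apply=> i; exact: space_compact.
by [].
Qed.

Lemma threads_hausdorff : hausdorff_space threads.
Proof. exact/hausdorff_set_type/prod_hausdorff. Qed.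

Lemma thread_proj_le i (x y : threads) :
  thread_proj i.+1 x = thread_proj i.+1 y -> thread_proj i x = thread_proj i y.
Proof.
by move=> xy; rewrite -(thread_proj_bond i x) -(thread_proj_bond i y) xy.
Qed.

Lemma threads_nbhs (x : threads) (U : set threads) : open U -> U x ->
  exists i V, [/\ open V, V (thread_proj i x) & thread_proj i @^-1` V `<=` U].
Proof.
apply: compact_jointly_injective_nbhs.
- exact: threads_compact.
- by move=> i; exact: space_hausdorff.
- exact: thread_proj_continuous.
- exact: thread_proj_le.
- by move=> y; exact: thread_ext.
Qed.

(** By [threads_nbhs] a neighbourhood is already visible at a single stage, so no finite
    intersections of pullbacks are required. Clopen bases and countable bases of the stages thus
    both pass to the limit. *)
Lemma threads_basis (B : forall i, set_system (D i)) :
  (forall i, basis (B i)) ->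
  basis (\bigcup_i ((fun V => thread_proj i @^-1` V) @` B i)).
Proof.
move=> Bb; split=> [_ [i _ [V BV <-]]|x U].
  by apply: open_comp => [y _|]; [exact: thread_proj_continuous |
    have [oB _] := Bb i; exact: oB].
rewrite nbhsE => -[O [oO Ox] OU].
have [i [V [oV Vx VO]]] := threads_nbhs oO Ox.
have [_ bB] := Bb i.
have [W [BW Wx WV]] := bB _ _ (open_nbhs_nbhs (conj oV Vx)).
exists (thread_proj i @^-1` W); first by split=> //; exists i => //; exists W.
by move=> y /WV /VO /OU.
Qed.

Lemma threads_zero_dim : has_clopen_basis threads.
Proof.
have Bi i := cid2 (space_zero_dim (D i)).
exists (\bigcup_i ((fun V => @thread_proj i @^-1` V) @` s2val (Bi i))).
  move=> _ [i _ [V BV <-]]; apply: preimage_clopen.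
    exact: s2valP (Bi i) _ BV.
  exact: thread_proj_continuous.
by apply: threads_basis => i; exact: s2valP'.
Qed.

Lemma threads_second_countable : @second_countable threads.
Proof.
have Bi i := cid2 (@space_second_countable (D i)).
exists (\bigcup_i ((fun V => @thread_proj i @^-1` V) @` s2val (Bi i))).
  apply: bigcup_countable => // i _.
  exact: card_le_trans (card_image_le _ _) (s2valP (Bi i)).
by apply: threads_basis => i; exact: s2valP'.
Qed.

Lemma threads_stable (x : threads) :
  threads (fun i => dyn (D i) (thread_proj i x)).
Proof. by move=> i; rewrite fact_equivariant thread_proj_bond. Qed.

Definition threads_dyn (x : threads) : threads :=
  exist _ (fun i => dyn (D i) (thread_proj i x)) (mem_set (threads_stable x)).

Lemma threads_dyn_continuous : continuous threads_dyn.
Proof.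
move=> x U; rewrite nbhsE => -[O [oO Ox] OU].
have [i [V [oV Vx VO]]] := threads_nbhs oO Ox.
have ct := continuousT_comp (@thread_proj_continuous i) (@dyn_continuous (D i)).
have : nbhs x (_ @^-1` V) := ct x _ (open_nbhs_nbhs (conj oV Vx)).
by apply: filterS => y Vy; apply/OU/VO.
Qed.

Definition threads_sys : detSys :=
  DetSys threads_zero_dim threads_second_countable threads_compact
    threads_hausdorff threads_dyn_continuous.

Lemma thread_proj_surj i (d : D i) : exists x, thread_proj i x = d.
Proof.
have [x [xD xi]] := surjective_tower_thread d (fun j => fact_surj (bond j)).
by exists (exist _ x (mem_set xD)).
Qed.

Lemma threads_nonempty : [set: threads_sys] !=set0.
Proof.
have [d _] := nedetSys_nonempty (D 0).
by have [x _] := thread_proj_surj d; exists x.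
Qed.

Definition inverse_limit : detSysEf := NeDetSys threads_nonempty.

Definition thread_proj_factor (i : nat) : factor inverse_limit (D i) :=
  @Factor threads_sys (D i) (@thread_proj i) (@thread_proj_continuous i)
    (@thread_proj_surj i) (fun=> erefl).

Definition thread_ef (i : nat) : Hom (D i) inverse_limit :=
  ef_of_factor (thread_proj_factor i).

Lemma inverse_limit_cocone : is_cocone thread_ef.
Proof. by move=> i; apply: ef_pair_eq => x; exact: thread_proj_bond. Qed.

Lemma inverse_limit_colimit : is_colimit thread_ef.
Proof.
by apply: jointly_injective_colimit; [exact: inverse_limit_cocone |
  move=> x y; exact: thread_ext].
Qed.

End InverseLimit.

(** The colimit is compared with the inverse limit, whose projections separate points: the
    comparison factor [ef_fact k] from [A] to threads has the left inverse [ef_fact h], hence is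
    injective. *)
Lemma colimit_jointly_injective (D : omega_chain detSysEf) (A : detSysEf)
    (f : forall i, Hom (D i) A) (a b : A) : is_colimit f ->
  (forall i, ef_fact (f i) a = ef_fact (f i) b) -> a = b.
Proof.
move=> [cf univ] fab.
have [h [hf _]] := univ _ _ (inverse_limit_cocone D).
have [_ /(_ _ _ cf)[k [kf _]]] := inverse_limit_colimit D.
(* Both sides mediate from the colimit cocone [f] to itself. *)
have kh : compm k h = idm A.
  have [u [_ uniq]] := univ _ _ cf.
  rewrite -(uniq (idm A)) => [|i]; last exact: comp1m.
  by apply/esym/uniq => i; rewrite -compmA hf kf.
have khE c : ef_fact h (ef_fact k c) = c by move/ef_eqP : kh; exact.
rewrite -(khE a) -(khE b); congr (ef_fact h _).
apply: thread_ext => i.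
by have /ef_eqP fE := kf i; rewrite [LHS]fE [RHS]fE.
Qed.

(** * Itineraries of a continuous finite colouring *)

Section Itinerary.
Variables (X : detSys) (A : finType) (c : X -> discrete_topology A).
Hypothesis c_continuous : continuous c.

Definition itinerary (x : X) : full_shift A :=
  fun k => c (iter k (dyn X) x).

Lemma letter_continuous k : continuous (fun x => c (iter k (dyn X) x)).
Proof.
suff it_continuous : continuous (iter k (dyn X)).
  exact: continuousT_comp it_continuous c_continuous.
elim: k => [|k IHk]; first by move=> x; exact: cvg_id.
exact: continuousT_comp IHk (@dyn_continuous X).
Qed.

Lemma itinerary_continuous : continuous itinerary.
Proof.
move=> x; apply/cvg_sup => k V [W [[O oO <-] /= Ox] WV].
have : nbhs x (_ @^-1` O) := letter_continuous (open_nbhs_nbhs (conj oO Ox)).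
by apply: filterS => y Oy; exact: WV.
Qed.

Lemma shift_map_itinerary x : shift_map (itinerary x) = itinerary (dyn X x).
Proof. by apply/funext => k; rewrite /shift_map /itinerary iterSr. Qed.

Lemma full_shift_hausdorff : hausdorff_space (full_shift A).
Proof.
apply: (@hausdorff_product nat (fun=> discrete_topology A)) => _.
exact: discrete_hausdorff.
Qed.

Lemma range_itinerary_closed : closed (range itinerary).
Proof.
apply: compact_closed_image; last exact: closedT.
- exact: space_compact.
- exact: full_shift_hausdorff.
- exact: itinerary_continuous.
Qed.

Lemma range_itinerary_stable :
  @shift_map A @` range itinerary `<=` range itinerary.
Proof.
by move=> _ [_ [x _ <-] <-]; rewrite shift_map_itinerary; exists (dyn X x).
Qed.

Definition itinerary_shift : shift A :=
  Shift range_itinerary_closed range_itinerary_stable.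

Definition itinerary_map (x : X) : shift_sys itinerary_shift :=
  exist _ (itinerary x) (mem_set (imageT itinerary x)).

Lemma itinerary_map_continuous : continuous itinerary_map.
Proof. by apply: continuous_comp_initial; exact: itinerary_continuous. Qed.

Lemma itinerary_map_surj (y : shift_sys itinerary_shift) :
  exists x, itinerary_map x = y.
Proof.
by case: y => y yS; have [x _ xy] := set_mem yS; exists x; exact: val_inj.
Qed.

Lemma itinerary_map_equivariant x :
  itinerary_map (dyn X x) = dyn _ (itinerary_map x).
Proof. by apply: val_inj; rewrite /= shift_map_itinerary. Qed.

Definition itinerary_factor : factor X (shift_sys itinerary_shift) :=
  Factor itinerary_map_continuous itinerary_map_surj itinerary_map_equivariant.

Lemma itinerary_factorP x y : itinerary_factor x = itinerary_factor y <->
  forall k, c (iter k (dyn X) x) = c (iter k (dyn X) y).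
Proof.
split=> [xy k|xy].
  have e := congr1 (fun z : shift_sys itinerary_shift => set_val z k) xy.
  exact: e.
have xyE : itinerary x = itinerary y by exact/funext.
exact: val_inj.
Qed.

End Itinerary.

(** * Shifts and finite objects *)

Lemma fact_iter (Y X : detSys) (f : factor Y X) k y :
  f (iter k (dyn Y) y) = iter k (dyn X) (f y).
Proof. by elim: k => //= k IHk; rewrite fact_equivariant IHk. Qed.

Lemma generating_partition_finite (B : detSysEf) (A : finType)
    (c : B -> discrete_topology A) : continuous c ->
  (forall x y,
    (forall k, c (iter k (dyn B) x) = c (iter k (dyn B) y)) -> x = y) ->
  finite_object B.
Proof.
move=> cc csep D L f fcolim g.
have cf := fcolim.1.
pose cg x := c (ef_fact g x).
have cgC : continuous cg.
  exact: continuousT_comp (@fact_continuous _ _ (ef_fact g)) cc.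
(* Otherwise, at every stage some pair of points agrees under [f i] but has different letters. These
   sets of pairs are closed, since equality of letters is an open condition, and nested; a common
   pair would consist of equal points, as the colimit separates points. *)
have [n fn] : exists n, forall x y,
    ef_fact (f n) x = ef_fact (f n) y -> cg x = cg y.
  apply: contrapT => nofn.
  have fstC : continuous (@fst L L) by move=> p; exact: cvg_fst.
  have sndC : continuous (@snd L L) by move=> p; exact: cvg_snd.
  have [|||| [x y] xyK] := @compact_nested_inhabited (L * L)%type (fun i =>
     [set p | ef_fact (f i) p.1 = ef_fact (f i) p.2] `&`
     ~` [set p | cg p.1 = cg p.2]).
  - have := @compact_setX L L setT setT (@space_compact L) (@space_compact L).
    by rewrite setXTT.
  - move=> i; apply: closedI.
      apply: closed_equalizer; first exact: space_hausdorff.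
        exact: continuousT_comp fstC (@fact_continuous _ _ (ef_fact (f i))).
      exact: continuousT_comp sndC (@fact_continuous _ _ (ef_fact (f i))).
    apply/open_closedC/open_equalizer_discrete.
      exact: continuousT_comp fstC cgC.
    exact: continuousT_comp sndC cgC.
  - move=> i; apply: contrapT => Ki0; apply: nofn; exists i => x y fxy.
    by apply: contrapT => cxy; apply: Ki0; exists (x, y).
  - move=> i p [/= fp cp]; split=> //.
    exact: cocone_fact_le (leqnSn i) fp.
  have [_] := xyK 0; apply; congr cg.
  apply: (colimit_jointly_injective fcolim) => i.
  by have [] := xyK i.
exists n => i ni.
(* Agreement at stage [i] is preserved by the dynamics, so the choice of [n] for a single letter
   controls the letters at all times [k], and these determine the point of [B]. *)
have [h hg] : exists h : factor (D i) B,
    forall x, h (ef_fact (f i) x) = ef_fact g x.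
  apply: factor_lift => x y fxy; apply: csep => k.
  rewrite -!fact_iter; apply: fn; rewrite !fact_iter; congr iter.
  exact: cocone_fact_le ni fxy.
exists (ef_of_factor h); split; first by apply: ef_pair_eq => x; rewrite /= hg.
move=> k gk; apply: (detSysEf_monic (f := f i)); rewrite -gk.
by apply: ef_pair_eq => x; rewrite /= hg.
Qed.

Lemma factor_nonempty (Y X : detSys) (f : factor Y X) :
  [set: Y] !=set0 -> [set: X] !=set0.
Proof. by case=> y _; exists (f y). Qed.

Lemma shift_chain_colimit (X : detSysEf) :
  exists (D : omega_chain detSysEf) (f : forall i, Hom (D i) X),
    (forall i, exists (A : finType) (S : shift A)
        (S0 : [set: shift_sys S] !=set0),
      D i = NeDetSys S0) /\ is_colimit f.
Proof.
have [C Cclopen Csep] := clopen_separating_sequence X.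
(* A letter of stage [n] is the bit vector of memberships in [C 0], ..., [C n.-1]; for [n = 0] there
   is just one letter. *)
pose c n (x : X) : discrete_topology {ffun 'I_n -> bool} :=
  [ffun i : 'I_n => `[< C i x >]].
have cC n : continuous (c n).
  apply: continuous_to_discrete => x.
  have : \forall y \near x, forall i : 'I_n, `[< C i y >] = `[< C i x >].
    apply: filter_forall => i; have [oC clC] := Cclopen i.
    have [Cx|nCx] := pselect (C i x).
      have : nbhs x (C i) by exact: open_nbhs_nbhs.
      by apply: filterS => y Cy; rewrite !asboolT.
    have : nbhs x (~` C i).
      by apply: open_nbhs_nbhs; split=> //; exact: closed_openC.
    by apply: filterS => y nCy; rewrite !asboolF.
  by apply: filterS => y yx; apply/ffunP => i; rewrite !ffunE.
pose D n : nedetSys :=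
  NeDetSys (factor_nonempty (itinerary_factor (cC n)) (nedetSys_nonempty X)).
pose f n : factor X (D n) := itinerary_factor (cC n).
(* The bonding factor forgets the last bit of every letter. *)
have bond n : {h : factor (D n.+1) (D n) | forall x, h (f n.+1 x) = f n x}.
  apply/cid/factor_lift => x y /itinerary_factorP xy.
  apply/itinerary_factorP => k.
  apply/ffunP => i; have /ffunP/(_ (widen_ord (leqnSn n) i)) := xy k.
  by rewrite !ffunE.
exists (@OmegaChain detSysEf D (fun n => ef_of_factor (sval (bond n)))).
exists (fun n => ef_of_factor (f n)); split.
  by move=> i; exists {ffun 'I_i -> bool}; eexists; eexists; reflexivity.
apply: jointly_injective_colimit.
  by move=> n; apply: ef_pair_eq => x; exact: svalP (bond n) x.
move=> x y xy; apply: Csep => n.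
(* Membership in [C n] first appears at stage [n.+1], as the last bit of the letter at time 0. *)
have /itinerary_factorP/(_ 0)/ffunP/(_ ord_max) := xy n.+1.
by rewrite !ffunE => e; exact: asbool_eq_equiv e.
Qed.

(** The letter at position 0 of the corresponding shift point is a generating partition: after [k]
    steps of the dynamics it is the letter at position [k]. *)
Lemma isomorphic_shift_finite (B : detSysEf) (A : finType) (S : shift A)
    (S0 : [set: shift_sys S] !=set0) :
  @isomorphic detSysEf B (NeDetSys S0) -> finite_object B.
Proof.
move=> [p [q [/ef_eqP qp _]]].
pose u : factor B (shift_sys S) := ef_fact q.
pose c (x : B) : discrete_topology A := set_val (u x) 0.
apply: (@generating_partition_finite B A c).
  have cs : continuous (fun x : shift_sys S => (set_val x : full_shift A) 0).
    apply: (@continuousT_comp _ _ _ set_val (fun x : full_shift A => x 0)).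
      exact: initial_continuous.
    exact: (@proj_continuous nat (fun=> discrete_topology A)).
  exact: continuousT_comp (@fact_continuous _ _ u) cs.
have cE k x : c (iter k (dyn B) x) = set_val (u x) k.
  rewrite /c fact_iter; move: (u x) => {x}.
  elim: k => // k IHk x; by rewrite iterSr IHk.
move=> x y xy; rewrite -[x]qp -[y]qp /=; congr (ef_fact p _).
apply: val_inj; apply: functional_extensionality_dep => k.
have := xy k; rewrite !cE; exact.
Qed.

(** Finiteness applied to [idm B] gives a right inverse [h] of some [f n]; since [f n] is monic, [h]
    is also a left inverse. *)
Lemma finite_isomorphic_shift (B : detSysEf) : finite_object B ->
  exists (A : finType) (S : shift A) (S0 : [set: shift_sys S] !=set0),
    @isomorphic detSysEf B (NeDetSys S0).
Proof.
move=> finB; have [D [f [shD fcolim]]] := shift_chain_colimit B.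
have [n /(_ n (leqnn n))[h [fh _]]] := finB D B f fcolim (idm B).
have [A [S [S0 Dn]]] := shD n; exists A, S, S0; rewrite -Dn.
exists h, (f n); split=> //.
apply: (detSysEf_monic (f := f n)).
by rewrite compmA -fh comp1m compm1.
Qed.

Lemma isomorphic_refl (C : category) (A : C) : isomorphic A A.
Proof. by exists (idm A), (idm A); rewrite compm1. Qed.

Theorem corollary8p8 :
  semi_algebroidal detSysEf /\
  forall B : detSysEf,
    finite_object B <->
    exists (A : finType) (X : shift A) (X0 : [set: shift_sys X] !=set0),
      @isomorphic detSysEf B (NeDetSys X0).
Proof.
split; last first.
  by move=> B; split=> [/finite_isomorphic_shift//|[A [S [S0]]]];
    exact: isomorphic_shift_finite.
split.
- exact: detSysEf_monic.
- move=> X; have [D [f [shD fcolim]]] := shift_chain_colimit X.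
  exists D, f; split=> // i; have [A [S [S0 ->]]] := shD i.
  exact: isomorphic_shift_finite (isomorphic_refl _).
- move=> D _; exists (inverse_limit D), (thread_ef D).
  exact: inverse_limit_colimit.
Qed.
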